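(* Let $d\ge 2$ and let $E$ and $E'$ be two non-degenerated self-affine Sierpiński sponges in $\mathbb{R}^d$ which are Lipschitz equivalent. Then: (i) if $E$ and all $\pi_j(E)$, $1\le j\le d-1$, possess trivial points, then so do $E'$ and all $\pi_j(E')$, $1\le j\le d-1$; (ii) if $E$ and all $\pi_j(E)$, $1\le j\le d-1$, are totally disconnected, then so are $E'$ and all $\pi_j(E')$, $1\le j\le d-1$.
   Context: Self-affine Sierpiński sponge in $\mathbb{R}^d$: given integers $2\le n_1<n_2<\dots<n_d$ and a non-empty $\mathcal{D}\subset\prod_{j=1}^d\{0,1,\dots,n_j-1\}$, let $\Lambda=\operatorname{diag}(n_1,\dots,n_d)$ and $S_{\mathbf{i}}(z)=\Lambda^{-1}(z+\mathbf{i})$ for $\mathbf{i}\in\mathcal{D}$, $z\in\mathbb{R}^d$. The sponge is the unique non-empty compact set $E$ with $E=\bigcup_{\mathbf{i}\in\mathcal{D}}S_{\mathbf{i}}(E)$; it carries the Euclidean metric. The data $(\{n_j\},\mathcal{D})$ defining $E$ and those defining $E'$ may be different. A sponge is degenerated if it is contained in a $(d-1)$-dimensional face of $[0,1]^d$, and non-degenerated otherwise. Projections: $\pi_j(x_1,\dots,x_d)=(x_1,\dots,x_j)$ for $1\le j\le d-1$. Trivial point: a point $z$ of a set $X$ is a trivial point of $X$ if $\{z\}$ is a connected component of $X$. Lipschitz equivalent: two metric spaces are Lipschitz equivalent if there is a bi-Lipschitz bijection between them. *)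

(* Defs.v *)
From HB Require Import structures.
From mathcomp Require Import all_boot all_order all_algebra.
From mathcomp Require Import all_classical all_reals all_analysis.

Set Implicit Arguments.
Unset Strict Implicit.
Unset Printing Implicit Defensive.

Import Order.TTheory GRing.Theory Num.Theory.
Import numFieldNormedType.Exports.

Local Open Scope classical_set_scope.
Local Open Scope ring_scope.

(* Points of R^d are row vectors 'rV[R]_d with coordinates 0 .. d-1, so the
   n_1 < ... < n_d and x_1, ..., x_d of the mathematical text are n 0 < ... and
   x 0 0, ...  The library's topology on 'rV[R]_d is the product topology,
   that is, the Euclidean one; its norm is however the sup norm, hence the
   explicit Euclidean distance below. *)
Definition euclid_dist (R : realType) (d : nat) (x y : 'rV[R]_d) : R :=
  Num.sqrt (\sum_(j < d) (x 0 j - y 0 j) ^+ 2).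

(* Elements of prod_j {0, ..., n_j - 1}. *)
Definition digit (d : nat) (n : 'I_d -> nat) : finType :=
  {dffun forall j : 'I_d, 'I_(n j)}.

(* z |-> Lambda^-1 (z + i), with Lambda = diag (n_1, ..., n_d). *)
Definition sponge_map (R : realType) (d : nat) (n : 'I_d -> nat)
    (i : digit n) (z : 'rV[R]_d) : 'rV[R]_d :=
  \row_(j < d) ((z 0 j + (i j : nat)%:R) / (n j)%:R).

(* By Hutchinson's theorem, at most one set E satisfies this for given (n, D)
   when all n_j >= 2 and D is non-empty, so this is "E is the sponge of
   (n, D)". *)
Definition is_sponge_of (R : realType) (d : nat) (n : 'I_d -> nat)
    (D : {set digit n}) (E : set 'rV[R]_d) : Prop :=
  [/\ E !=set0, compact E &
      E = \bigcup_(i in [set i : digit n | i \in D]) (sponge_map i @` E)].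

Definition sierpinski_sponge (R : realType) (d : nat) (E : set 'rV[R]_d) :
    Prop :=
  exists (n : 'I_d -> nat) (D : {set digit n}),
    [/\ forall j, (2 <= n j)%N,
        forall j k : 'I_d, (j < k)%N -> (n j < n k)%N,
        exists i, i \in D
      & is_sponge_of D E].

(* The (d-1)-dimensional face {x in [0,1]^d | x_j = b}, b being 0 or 1. *)
Definition cube_face (R : realType) (d : nat) (j : 'I_d) (b : bool) :
    set 'rV[R]_d :=
  [set x | (forall k, 0 <= x 0 k <= 1) /\ x 0 j = b%:R].

Definition degenerated (R : realType) (d : nat) (E : set 'rV[R]_d) : Prop :=
  exists (j : 'I_d) (b : bool), E `<=` @cube_face R d j b.

(* The projection onto the first j coordinates, for j < d. *)
Definition coord_proj (R : realType) (d : nat) (j : 'I_d) (x : 'rV[R]_d) :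
    'rV[R]_j :=
  \row_(k < j) x 0 (widen_ord (ltnW (ltn_ord j)) k).

Definition trivial_point (T : topologicalType) (X : set T) (z : T) : Prop :=
  X z /\ connected_component X z = [set z].

Definition has_trivial_point (T : topologicalType) (X : set T) : Prop :=
  exists z, trivial_point X z.

Definition lipschitz_equivalent (R : realType) (d d' : nat)
    (E : set 'rV[R]_d) (E' : set 'rV[R]_d') : Prop :=
  exists (f : 'rV[R]_d -> 'rV[R]_d') (c : R),
    [/\ set_bij E E' f, 0 < c &
        forall x y, E x -> E y ->
          c^-1 * euclid_dist x y <= euclid_dist (f x) (f y)
                                 <= c * euclid_dist x y].

(* Main.v *)
(* Call a point y of X uniformly trivial if, for some C and every delta > 0, it
   lies in a part of X of diameter at most C delta whose distance to the rest of
   X is at least delta.  Both "some point is uniformly trivial" and "all points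
   are, with the same C" are bi-Lipschitz invariants, and they characterize the
   hypotheses of (i) and (ii).

   If y is uniformly trivial and lies in a cylinder of rank k, take delta of the
   order of n_{j+1}^-k: at this scale the cylinder is a copy of pi_j(E), so
   pi_j(E) has small parts separated from the rest.  Conversely, coordinate j
   of E is controlled at scale n_j^-k by copies in pi_j(E) of a separated part
   which is either small with uniform gaps (total disconnectedness) or in the
   interior of the cube (trivial points).

   In a non-degenerated sponge X, a separated part G touching the fewest faces of
   the cube touches none.  Otherwise every cylinder whose copy of G would touch
   fewer faces meets a cylinder lying further towards the faces touched by G, so
   that each cylinder is chained to its push to these faces, and no separated
   part can distinguish the two; but a copy of G in a pushed cylinder does. *)
Require Import Defs.
From HB Require Import structures.
From mathcomp Require Import all_boot all_order all_algebra.
From mathcomp Require Import all_classical all_reals all_analysis.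
From mathcomp Require Import zify ring lra.

Import Order.TTheory GRing.Theory Num.Theory.
Import numFieldNormedType.Exports.

Local Open Scope classical_set_scope.
Local Open Scope ring_scope.

Set Implicit Arguments.
Unset Strict Implicit.
Unset Printing Implicit Defensive.

(** * Separated parts of compact sets *)

(** Closeness is coordinatewise because cylinders are boxes with very different sides. *)
Definition close (R : realType) (d : nat) (e : R) (x y : 'rV[R]_d) :=
  forall j, `|x 0 j - y 0 j| < e.

Definition detached (R : realType) (d : nat) (e : R) (G X : set 'rV[R]_d) :=
  G `<=` X /\ forall x y, G x -> X y -> close e x y -> G y.

Section Detached.
Context {R : realType} {d : nat}.
Implicit Types (x y z : 'rV[R]_d) (e : R) (A B G X : set 'rV[R]_d).

Lemma close_sym e x y : close e x y -> close e y x.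
Proof. by move=> h j; rewrite distrC. Qed.

Lemma closeD e1 e2 y x z : close e1 x y -> close e2 y z -> close (e1 + e2) x z.
Proof.
move=> h1 h2 j; rewrite -[x 0 j](subrK (y 0 j)) -addrA.
by apply: le_lt_trans (ler_normD _ _) _; apply: ltrD.
Qed.

Lemma close_le e1 e2 x y : e1 <= e2 -> close e1 x y -> close e2 x y.
Proof. by move=> le h j; apply: lt_le_trans (h j) le. Qed.

Lemma nbhs_close x A :
  nbhs x A <-> exists2 e, 0 < e & forall y, close e x y -> A y.
Proof.
rewrite nbhs_ballP; split=> -[e e0 h]; exists e => // y hy; apply: h.
  by split=> // i j; rewrite (ord1 i); exact: hy.
by case: hy => _ hy j; exact: hy.
Qed.

Lemma closed_close A x :
  closed A -> (forall e, 0 < e -> exists2 y, A y & close e x y) -> A x.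
Proof.
move=> cA h; apply: cA => B /nbhs_close[e e0 hB].
by have [y Ay /hB By] := h e e0; exists y.
Qed.

Lemma compact_closedRV A : compact A -> closed A.
Proof. by apply: compact_closed; exact: norm_hausdorff. Qed.

(** Near-covering form of compactness: bounds that persist at nearby points and for smaller [e] have
    a common value. *)
Lemma compact_uniform (K : set 'rV[R]_d) (P : R -> 'rV[R]_d -> Prop) :
  compact K ->
  (forall x, K x -> exists2 e, 0 < e &
     forall e' x', 0 < e' <= e -> close e x x' -> P e' x') ->
  exists2 e, 0 < e & forall x, K x -> P e x.
Proof.
move=> /compact_near_coveringP cK hP.
have H : \forall e \near 0^'+, K `<=` P e.
  apply: cK => x Kx; have [e e0 he] := hP _ Kx.
  exists ([set x' | close e x x'], [set e' | 0 < e' <= e]) => /=.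
    split; first by apply/nbhs_close; exists e.
    near=> t; apply/andP; split; first by near: t; exact: nbhs_right_gt.
    by near: t; exact: nbhs_right_le.
  by move=> [x' e'] [/= h1 h2]; exact: he.
near (0:R)^'+ => t; exists t; first by [].
by near: t; exact: H.
Unshelve. all: by end_near. Qed.

Lemma compact_gap A B : compact A -> closed B -> A `&` B = set0 ->
  exists2 e, 0 < e & forall a b, A a -> B b -> ~ close e a b.
Proof.
move=> cA cB AB0.
have [e e0 he] : exists2 e, 0 < e & forall a, A a -> forall b, B b -> ~ close e a b.
  apply: (compact_uniform (P := fun e a => forall b, B b -> ~ close e a b)) => //.
  move=> x Ax; have nBx : ~ B x by move=> Bx; have : (A `&` B) x by []; rewrite AB0.
  have /existsNP[e /not_implyP[e0 he]] :
      ~ (forall e, 0 < e -> exists2 y, B y & close e x y).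
    by move=> h; apply: nBx; exact: closed_close.
  exists (e / 2); first by rewrite divr_gt0.
  move=> e' x' /andP[_ e'e] xx' b Bb x'b; apply: he; exists b => //.
  by apply: close_le (closeD xx' x'b); lra.
by exists e => // a b Aa; exact: he.
Qed.

Lemma detached_le e e' G X : e' <= e -> detached e G X -> detached e' G X.
Proof.
by move=> le [GX h]; split=> // x y Gx Xy xy; apply: h Gx Xy (close_le le xy).
Qed.

Lemma detached_self e X : detached e X X.
Proof. by split. Qed.

Lemma detachedI e G H X :
  detached e G X -> detached e H X -> detached e (G `&` H) X.
Proof.
move=> [GX hG] [HX hH]; split=> [x [/GX]//|x y [Gx Hx] Xy xy].
by split; [apply: hG xy|apply: hH xy].
Qed.

Lemma detached_closed e G X : 0 < e -> closed X -> detached e G X -> closed G.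
Proof.
move=> e0 cX [GX h] x xG.
have hx e' : 0 < e' -> exists2 y, G y & close e' x y.
  move=> e'0; have [|y [Gy xy]] := xG (close e' x); last by exists y.
  by apply/nbhs_close; exists e'.
have Xx : X x.
  by apply: closed_close => // e' /hx[y /GX Xy xy]; exists y.
by have [y Gy xy] := hx e e0; apply: h Gy Xx (close_sym xy).
Qed.

Lemma detached_compact e G X : 0 < e -> compact X -> detached e G X -> compact G.
Proof.
move=> e0 cX hG; rewrite -(setIidr (proj1 hG)); apply: compact_closedI => //.
by apply: detached_closed hG => //; exact: compact_closedRV.
Qed.

Lemma nbhs_closeE e x : 0 < e -> nbhs x (close e x).
Proof. by move=> e0; apply/nbhs_close; exists e. Qed.

(** [G] and its complement in [X] are both relatively open, so a connected subset of [X] meeting [G]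
    stays in [G]. *)
Lemma detached_component e G X z :
  0 < e -> detached e G X -> G z -> connected_component X z `<=` G.
Proof.
move=> e0 [GX h] Gz; set C := connected_component X z.
have CX : C `<=` X by exact: connected_component_sub.
have Cz : C z by apply: connected_component_refl; exact: GX.
suff <- : C `&` G = C by move=> x [].
apply: (@component_connected _ X z).
- by exists z.
- exists (\bigcup_(g in G) (close e g)°).
    by apply: bigcup_open => g _; exact: open_interior.
  apply/seteqP; split=> x [Cx].
    by move=> Gx; split=> //; exists x => //; exact: nbhs_closeE.
  by move=> [g Gg /interior_subset gx]; split=> //; apply: h gx => //; exact: CX.
- exists (~` \bigcup_(g in X `\` G) (close e g)°).
    by apply: open_closedC; apply: bigcup_open => g _; exact: open_interior.
  apply/seteqP; split=> x [Cx].
    move=> Gx; split=> // -[y [Xy nGy] /interior_subset yx].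
    by apply: nGy; apply: h Gx Xy _; exact: close_sym.
  move=> hx; split=> //; apply: contrapT => nGx; apply: hx.
  by exists x; [split=> //; exact: CX|exact: nbhs_closeE].
Qed.

(** In a compact set the detached parts are the clopen ones, so this is the classical
    quasi-component of [z]. *)
Definition quasi_component X z : set 'rV[R]_d :=
  [set x | forall e G, 0 < e -> detached e G X -> G z -> G x].

(** If every detached part around [z] left [O], the sets [G \ O] would generate a proper filter,
    with a cluster point in the quasi-component but outside [O]. *)
Lemma quasi_component_nbhs X z (O : set 'rV[R]_d) :
  compact X -> X z -> open O -> quasi_component X z `<=` O ->
  exists e G, [/\ 0 < e, detached e G X, G z & G `<=` O].
Proof.
move=> cX Xz oO hO; apply: contrapT => hn.
pose D := [set G | exists e, [/\ 0 < e, detached e G X & G z]].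
pose F := filter_from D (fun G => G `\` O).
have FF : Filter F.
  apply: filter_from_filter; first by exists X, 1; split=> //; exact: detached_self.
  move=> G H [e [e0 iG Gz]] [e' [e'0 iH Hz]]; exists (G `&` H).
    exists (Num.min e e'); split=> //; first by rewrite lt_min e0.
    by apply: detachedI; [apply: detached_le iG|apply: detached_le iH];
       rewrite ge_min lexx ?orbT.
  by move=> x [[Gx Hx] nOx].
have PF : ProperFilter F.
  apply: filter_from_proper => G [e [e0 iG Gz]]; apply: contrapT => hG.
  apply: hn; exists e, G; split=> // x Gx; apply: contrapT => nOx.
  by apply: hG; exists x.
have FX : F X.
  by exists X => [|x []//]; exists 1; split=> //; exact: detached_self.
have [y [Xy yF]] := cX F PF FX.
have FG G e : 0 < e -> detached e G X -> G z -> F (G `\` O).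
  by move=> e0 iG Gz; exists G => //; exists e.
have nOy : ~ O y.
  move=> Oy; have [|x [[_ nOx] Ox]] := yF _ O (FG X 1 ltr01 (detached_self _ _) Xz).
    exact: open_nbhs_nbhs.
  by [].
apply/nOy/hO => e G e0 iG Gz.
apply: (detached_closed e0 (compact_closedRV cX) iG) => B yB.
by have [x [[Gx _] Bx]] := yF _ B (FG G e e0 iG Gz) yB; exists x.
Qed.

(** A splitting of the quasi-component extends, by compactness, to a detached part of [X] that
    contains [z] and misses one of the two pieces. *)
Lemma quasi_component_connected X z :
  compact X -> X z -> connected (quasi_component X z).
Proof.
move=> cX Xz; set K := quasi_component X z.
have Kz : K z by move=> e G _ _.
have KX : K `<=` X by move=> x Kx; apply: (Kx 1 X) => //; exact: detached_self.
have cK : closed K.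
  move=> x xK e G e0 iG Gz.
  apply: (detached_closed e0 (compact_closedRV cX) iG) => B /xK[y [Ky By]].
  by exists y; split=> //; exact: Ky iG Gz.
apply: contrapT => /connectedPn[E [E0 KE [sep1 sep2]]].
have [b Ebz] : exists b, E b z.
  by move: Kz; rewrite KE => -[]; [exists false|exists true].
have EK c : E c `<=` K by move=> x; rewrite KE; case: c; [right|left].
have sep : closure (E b) `&` E (~~ b) = set0 /\ closure (E (~~ b)) `&` E b = set0.
  by case: b {Ebz}; rewrite /= ?[closure (E true) `&` _]setIC.
have Ebd : E b `&` E (~~ b) = set0.
  by apply: subsetI_eq0 (proj1 sep) => //; exact: subset_closure.
have cE c : closure (E c) `&` E (~~ c) = set0 -> closed (E c).
  move=> hc x xE; have : K x by apply: cK; apply: closureS xE; exact: EK.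
  rewrite KE => hx.
  have [//|h] : E c x \/ E (~~ c) x by case: (c) hx => /= -[]; auto.
  by have : (closure (E c) `&` E (~~ c)) x by []; rewrite hc.
have cEb := cE b (proj1 sep).
have cEnb : closed (E (~~ b)) by apply: cE; rewrite negbK; exact: (proj2 sep).
have kE : compact (E b).
  rewrite -(setIidr (subset_trans (EK b) KX)); exact: compact_closedI.
have [e e0 he] := compact_gap kE cEnb Ebd.
(* The chain from [a] through [x] and [y] to [w] has three steps shorter than [r]. *)
pose r := e / 3; have r0 : 0 < r by rewrite divr_gt0.
pose U := \bigcup_(a in E b) (close r a)°.
pose W := \bigcup_(a in E (~~ b)) (close r a)°.
have oUW : open (U `|` W).
  by apply: openU; apply: bigcup_open => g _; exact: open_interior.
have KUW : K `<=` U `|` W.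
  move=> x; rewrite KE => hx.
  have [h|h] : E b x \/ E (~~ b) x by case: (b) hx => /= -[]; auto.
    by left; exists x => //; exact: nbhs_closeE.
  by right; exists x => //; exact: nbhs_closeE.
have [e1 [G [e10 iG Gz GUW]]] := quasi_component_nbhs cX Xz oUW KUW.
have iGU : detached (Num.min e1 r) (G `&` U) X.
  split=> [x [Gx _]|x y [Gx Ux] Xy xy]; first exact: (proj1 iG).
  have Gy : G y by apply: (proj2 iG) Gx Xy (close_le _ xy); rewrite ge_min lexx.
  split=> //; have [//|[w Ew /interior_subset wy]] := GUW _ Gy.
  have [a Ea /interior_subset ax] := Ux.
  have := he a w Ea Ew; case.
  have xy' : close r x y by apply: close_le xy; rewrite ge_min lexx orbT.
  apply: close_le (closeD (closeD ax xy') (close_sym wy)).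
  by rewrite /r; lra.
have [w Ew] := E0 (~~ b).
have [||_ [a Ea /interior_subset aw]] := EK _ _ Ew _ _ _ iGU.
- by rewrite lt_min e10 r0.
- by split=> //; exists z => //; exact: nbhs_closeE.
by apply: (he a w Ea Ew); apply: close_le aw; rewrite /r; lra.
Qed.

(** The quasi-component of [z] is connected, hence reduced to [z]. *)
Lemma trivial_point_detached X z (eta : R) : compact X -> trivial_point X z ->
  0 < eta -> exists e G, [/\ 0 < e, detached e G X, G z & G `<=` close eta z].
Proof.
move=> cX [Xz hz] eta0.
have [||e [G [e0 iG Gz hG]]] := @quasi_component_nbhs X z (close eta z)° cX Xz.
- exact: open_interior.
- move=> x xz; suff -> : x = z by exact: nbhs_closeE.
  have : connected_component X z x.
    exists (quasi_component X z) => //; split.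
    - by move=> e G _ _.
    - by move=> y yz; apply: (yz 1 X) => //; exact: detached_self.
    - exact: quasi_component_connected.
  by rewrite hz.
by exists e, G; split=> // x /hG /interior_subset.
Qed.

Lemma detached_trivial_point X z : X z ->
  (forall eta, 0 < eta -> exists e G,
     [/\ 0 < e, detached e G X, G z & G `<=` close eta z]) ->
  trivial_point X z.
Proof.
move=> Xz h; split=> //; apply/seteqP; split=> x; last first.
  by move=> ->; exact: connected_component_refl.
move=> zx; apply/rowP => j; apply/eqP; rewrite -subr_eq0 -normr_eq0 distrC.
apply/negPn/negP => n0.
have [|e [G [e0 iG Gz hG]]] := h `|z 0 j - x 0 j|; first by rewrite lt0r n0 /=.
have /hG/(_ j) := detached_component e0 iG Gz zx.
by rewrite ltxx.
Qed.

End Detached.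

(** * Self-affine sets and their cylinders *)

(** A composition of [m] sponge maps is encoded by the integer position [p] of its cylinder in the
    grid of mesh [n j ^ -m]. *)
Definition cmap (R : realType) (d : nat) (n : 'I_d -> nat) (m : nat)
    (p : 'I_d -> nat) (z : 'rV[R]_d) : 'rV[R]_d :=
  \row_j ((z 0 j + (p j)%:R) / (n j ^ m)%:R).

Definition cell (R : realType) (d : nat) (n : 'I_d -> nat)
    (X : set 'rV[R]_d) (m : nat) (p : 'I_d -> nat) :=
  (forall j, p j < n j ^ m)%N /\ forall z, X z -> X (cmap n m p z).

(** No digit set appears, so that the notion passes at once to coordinate projections. *)
Record self_affine (R : realType) (d : nat) (n : 'I_d -> nat)
    (X : set 'rV[R]_d) : Prop := SelfAffine {
  sa_ge2 : forall j, (2 <= n j)%N;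
  sa_neq0 : X !=set0;
  sa_compact : compact X;
  sa_unit : forall x j, X x -> 0 <= x 0 j <= 1;
  sa_cover : forall m x, X x ->
    exists p z, [/\ cell n X m p, X z & x = cmap n m p z] }.

Definition touches (R : realType) (d : nat) (G : set 'rV[R]_d)
    (a : 'I_d) (b : bool) := exists2 g, G g & g 0 a = b%:R.

Definition island (R : realType) (d : nat) (X : set 'rV[R]_d) :=
  exists e G, [/\ 0 < e, detached e G X, G !=set0 & forall a b, ~ touches G a b].

Lemma pow_small (R : realType) (e : R) : 0 < e ->
  exists m, forall N m', (2 <= N)%N -> (m <= m')%N -> (N ^ m')%:R^-1 < e.
Proof.
move=> e0; exists (Num.truncn e^-1).+1 => N m' N2 mm'.
have Nm0 : (0 : R) < (N ^ m')%:R by rewrite ltr0n expn_gt0; lia.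
rewrite -[ltRHS]invrK ltf_pV2 ?posrE ?invr_gt0 //.
apply: lt_le_trans (truncnS_gt _) _; rewrite ler_nat.
apply: leq_trans mm' _; exact: ltnW (ltn_expl _ N2).
Qed.

Lemma unit_shift_eq (R : realType) (g z : R) (p q : nat) :
  0 <= g <= 1 -> 0 <= z <= 1 -> g + p%:R = z + q%:R ->
  [\/ q = p, q = p.+1 /\ g = 1 | p = q.+1 /\ g = 0].
Proof.
move=> g01 z01 e; have [pq|qp|->] := ltngtP p q; last by apply: Or31.
- have h : (p%:R + 1 : R) <= q%:R by rewrite natr1 ler_nat.
  have h1 : q%:R = (p%:R + 1 : R) by lra.
  apply: Or32; split; last by lra.
  by apply/eqP; rewrite -(eqr_nat R) -natr1 h1.
- have h : (q%:R + 1 : R) <= p%:R by rewrite natr1 ler_nat.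
  have h1 : p%:R = (q%:R + 1 : R) by lra.
  apply: Or33; split; last by lra.
  by apply/eqP; rewrite -(eqr_nat R) -natr1 h1.
Qed.

Lemma frac_comp (F : fieldType) (a b c r s : F) : r != 0 -> s != 0 ->
  ((a + b) / s + c) / r = (a + (c * s + b)) / (r * s).
Proof. by move=> r0 s0; field; rewrite r0 s0. Qed.

Section SelfAffineSets.
Context {R : realType} {d : nat} (n : 'I_d -> nat) (X : set 'rV[R]_d).
Hypothesis sa : self_affine n X.
Implicit Types (x y z : 'rV[R]_d) (e : R) (G H : set 'rV[R]_d) (p q : 'I_d -> nat).

Lemma npow_gt0 j m : (0 : R) < (n j ^ m)%:R.
Proof. by rewrite ltr0n expn_gt0; have := sa_ge2 sa j; lia. Qed.

Lemma npow_ge1 j m : (1 : R) <= (n j ^ m)%:R.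
Proof. by rewrite ler1n -(ltr0n R) npow_gt0. Qed.

Lemma cmap_eq m p q z z' : cmap n m p z = cmap n m q z' ->
  forall j, z 0 j + (p j)%:R = z' 0 j + (q j)%:R.
Proof.
move=> /rowP h j; move: (h j); rewrite !mxE.
by apply: mulIf; rewrite invr_eq0 gt_eqF // npow_gt0.
Qed.

Lemma cmap_shift_eq m p q z z' : (forall j, z 0 j + (p j)%:R = z' 0 j + (q j)%:R) ->
  cmap n m p z = cmap n m q z'.
Proof. by move=> h; apply/rowP => j; rewrite !mxE h. Qed.

Lemma cmap_dist m p q z z' j :
  `|cmap n m p z 0 j - cmap n m q z' 0 j| =
  `|z 0 j + (p j)%:R - (z' 0 j + (q j)%:R)| / (n j ^ m)%:R.
Proof. by rewrite !mxE -mulrBl normrM normfV [`|_%:R|]ger0_norm. Qed.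

Lemma cmap_dist_same m p z z' j :
  `|cmap n m p z 0 j - cmap n m p z' 0 j| = `|z 0 j - z' 0 j| / (n j ^ m)%:R.
Proof. by rewrite cmap_dist; congr (`|_| / _); ring. Qed.

Lemma unit_dist x y j : X x -> X y -> `|x 0 j - y 0 j| <= 1.
Proof.
move=> Xx Xy; have := sa_unit sa j Xx; have := sa_unit sa j Xy.
by rewrite ler_norml; lra.
Qed.

Lemma cell_dist m p z z' j : X z -> X z' ->
  `|cmap n m p z 0 j - cmap n m p z' 0 j| <= (n j ^ m)%:R^-1.
Proof.
move=> Xz Xz'; rewrite cmap_dist_same ler_pdivrMr ?npow_gt0 //.
by rewrite mulVf ?unit_dist // gt_eqF // npow_gt0.
Qed.

Definition pcomp m p p' j := (p j * n j ^ m + p' j)%N.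

Lemma cmap_comp m m' p p' z :
  cmap n m p (cmap n m' p' z) = cmap n (m + m') (pcomp m' p p') z.
Proof.
apply/rowP => j; rewrite !mxE expnD /pcomp !natrD !natrM.
by rewrite frac_comp // lt0r_neq0 // npow_gt0.
Qed.

Lemma cell_comp m m' p p' :
  cell n X m p -> cell n X m' p' -> cell n X (m + m') (pcomp m' p p').
Proof.
move=> [h1 h2] [h1' h2']; split=> [j|z Xz].
  by rewrite /pcomp expnD; have := h1 j; have := h1' j; nia.
by rewrite -cmap_comp; apply: h2; exact: h2'.
Qed.

Lemma cmap0 z : cmap n 0 (fun=> 0%N) z = z.
Proof. by apply/rowP => j; rewrite mxE expn0 addr0 divr1. Qed.

(** The map contracts to the point with coordinates [p j / (n j ^ m - 1)]; orbits of points of the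
    closed set [X] converge to it. *)
Lemma cell_fixpoint m p : (0 < m)%N -> cell n X m p ->
  exists2 y, X y & cmap n m p y = y.
Proof.
move=> m0 [hp cp].
have N2 j : (2 : R) <= (n j ^ m)%:R.
  rewrite ler_nat; apply: leq_trans (sa_ge2 sa j) _.
  by rewrite -{1}(expn1 (n j)) leq_exp2l //; have := sa_ge2 sa j; lia.
have pN j : (p j)%:R + 1 <= ((n j ^ m)%:R : R) by rewrite natr1 ler_nat.
pose y : 'rV[R]_d := \row_j ((p j)%:R / ((n j ^ m)%:R - 1)).
have y01 j : 0 <= y 0 j <= 1.
  have := N2 j; have := pN j; have : (0 : R) <= (p j)%:R by [].
  rewrite mxE => h0 h1 h2; apply/andP; split; first by rewrite divr_ge0 //; lra.
  by rewrite ler_pdivrMr; lra.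
have fy : cmap n m p y = y.
  apply/rowP => j; rewrite !mxE.
  have : ((n j ^ m)%:R : R) - 1 != 0 by have := N2 j; lra.
  have : ((n j ^ m)%:R : R) != 0 by have := N2 j; lra.
  by move=> h1 h2; field; rewrite h1 h2.
exists y => //; have [x0 Xx0] := sa_neq0 sa.
apply: closed_close; first by apply: compact_closedRV; exact: sa_compact sa.
move=> e e0; have [t /(_ 2%N t isT (leqnn _)) ht] := pow_small e0.
exists (iter t (cmap n m p) x0); first by elim: (t) => //= k; exact: cp.
move=> j; apply: le_lt_trans ht.
elim: t => [|t IH] /=.
  rewrite expn0 invr1; have := y01 j; have := sa_unit sa j Xx0.
  by rewrite ler_norml; lra.
rewrite -{1}fy cmap_dist_same expnS natrM invfM mulrC.
by apply: ler_pM => //; rewrite lef_pV2 ?posrE ?npow_gt0.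
Qed.

Lemma cell_iter m p y : cell n X m p -> cmap n m p y = y ->
  forall t, exists2 q, cell n X (t * m) q & cmap n (t * m) q y = y.
Proof.
move=> cp fy; elim=> [|t [q cq hq]].
  exists (fun=> 0%N); rewrite mul0n ?cmap0 //; split=> [j|z]; first by rewrite expn0.
  by rewrite cmap0.
exists (pcomp (t * m) p q); first by rewrite mulSn; exact: cell_comp.
by rewrite mulSn -cmap_comp hq.
Qed.

Lemma cell_in_detached m e p G z : (forall j, (n j ^ m)%:R^-1 < e) ->
  detached e G X -> cell n X m p -> X z -> G (cmap n m p z) ->
  forall z', X z' -> G (cmap n m p z').
Proof.
move=> he iG cp Xz Gz z' Xz'; apply: (proj2 iG) Gz (proj2 cp _ Xz') _ => j.
exact: le_lt_trans (cell_dist _ _ _ Xz Xz') (he j).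
Qed.

Lemma detached_has_cell e G z : 0 < e -> detached e G X -> G z ->
  exists m p, [/\ (0 < m)%N, cell n X m p & forall x, X x -> G (cmap n m p x)].
Proof.
move=> e0 iG Gz; have [m hm] := pow_small e0.
have [p [z1 [cp Xz1 hz]]] := sa_cover sa m.+1 (proj1 iG _ Gz).
exists m.+1, p; split=> //; apply: (cell_in_detached _ iG cp Xz1); last by rewrite -hz.
by move=> j; apply: hm => //; exact: sa_ge2 sa j.
Qed.

Definition translate (v : 'I_d -> int) z : 'rV[R]_d := \row_j (z 0 j + (v j)%:~R).

(** Seen from a cylinder rescaled to unit size, the other cylinders of its rank lie in integer
    translates of [X]; this condition excludes near misses at all ranks at once. *)
Definition translate_gap e G := forall v g z, G g -> X z ->
  close e g (translate v z) ->
  exists g' z', [/\ G g', X z' & g' = translate v z'].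

Definition shift3 (f : {ffun 'I_d -> 'I_3}) (j : 'I_d) : int := (f j : nat)%:Z - 1.

Lemma shift3_surj (v : 'I_d -> int) : (forall j, `|(v j)%:~R : R| < 2) ->
  exists f, v = shift3 f.
Proof.
move=> hv; exists [ffun j => inord (absz (v j + 1))]; apply/funext => j.
move: (hv j); rewrite ltr_norml => /andP[h1 h2].
have v1 : (-2)%:~R < ((v j)%:~R : R) by rewrite (_ : (-2)%:~R = -2).
have v2 : ((v j)%:~R : R) < 2%:~R by rewrite (_ : 2%:~R = 2).
move: v1 v2; rewrite !ltr_int => v1 v2; rewrite /shift3 ffunE inordK; lia.
Qed.

Lemma translate_closed v : closed (translate v @` X).
Proof.
move=> x xX; pose w : 'rV[R]_d := \row_j (x 0 j - (v j)%:~R).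
have Xw : X w.
  apply: closed_close; first by apply: compact_closedRV; exact: sa_compact sa.
  move=> e e0; have [|y [[z Xz <-] hy]] := xX (close e x).
    exact: nbhs_closeE.
  exists z => // j; have := hy j; rewrite !mxE.
  by rewrite (_ : x 0 j - (v j)%:~R - z 0 j = x 0 j - (z 0 j + (v j)%:~R)) //; ring.
by exists w => //; apply/rowP => j; rewrite !mxE; ring.
Qed.

(** Only translates by vectors with entries -1, 0, 1 come within distance 1 of [G]. Each of these
    finitely many meets the compact set [G] or keeps a positive distance from it. *)
Lemma translate_gap_exists e G : 0 < e -> detached e G X ->
  exists e', [/\ 0 < e', detached e' G X & translate_gap e' G].
Proof.
move=> e0 iG; have cG := detached_compact e0 (sa_compact sa) iG.
pose T := {ffun 'I_d -> 'I_3}.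
have /choice[r hr] : forall f : T, exists r : R, 0 < r /\
    forall g z, G g -> X z -> close r g (translate (shift3 f) z) ->
    exists g' z', [/\ G g', X z' & g' = translate (shift3 f) z'].
  move=> f; have [[x [Gx [z Xz zx]]]|h] := pselect (G `&` translate (shift3 f) @` X !=set0).
    by exists 1; split=> // g z' _ _ _; exists x, z.
  have GX0 : G `&` translate (shift3 f) @` X = set0.
    by apply/seteqP; split=> // x hx; apply: h; exists x.
  have [r r0 hr] := compact_gap cG (@translate_closed (shift3 f)) GX0.
  by exists r; split=> // g z Gg Xz /hr; case=> //; exists z.
pose e1 := Num.min (Num.min 1 e) (\big[Num.min/1]_(f : T) r f).
have e1r f : e1 <= r f by rewrite /e1 ge_min bigmin_le ?orbT.
exists e1; split.
- rewrite /e1 !lt_min ltr01 e0 /=; apply: lt_bigmin => // f _.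
  by have [] := hr f.
- by apply: detached_le iG; rewrite /e1 !ge_min lexx ?orbT.
- move=> v g z Gg Xz gz.
  have [f vf] : exists f, v = shift3 f.
    apply: shift3_surj => j; have := gz j; rewrite !mxE.
    have e11 : e1 <= 1 by rewrite /e1 !ge_min lexx.
    have := sa_unit sa j Xz; have := sa_unit sa j (proj1 iG _ Gg).
    by move=> hg hz /lt_le_trans /(_ e11); rewrite !ltr_norml; lra.
  rewrite vf in gz *; have [_ h] := hr f.
  by apply: h Gg Xz _; apply: close_le gz.
Qed.

Lemma cmap_translate m p q z :
  cmap n m p (translate (fun j => (q j)%:Z - (p j)%:Z) z) = cmap n m q z.
Proof.
apply: cmap_shift_eq => j.
by rewrite mxE rmorphB /= -!pmulrn; ring.
Qed.

(** As [n l] is the largest base, [n l ^ -m] is the shortest side of a rank [m] cylinder. *)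
Lemma close_cmap m p q e g z l : (forall j, n j <= n l)%N -> 0 < e ->
  close (e / (n l ^ m)%:R) (cmap n m p g) (cmap n m q z) ->
  close e g (translate (fun j => (q j)%:Z - (p j)%:Z) z).
Proof.
move=> nl e0 gz j; have := gz j; rewrite cmap_dist ltr_pdivrMr ?npow_gt0 //.
rewrite !mxE rmorphB /= => h.
rewrite (_ : g 0 j - _ = g 0 j + (p j)%:R - (z 0 j + (q j)%:R)).
  apply: lt_le_trans h _; rewrite -[leRHS]mulr1 -mulrA ler_pM2l //.
  rewrite mulrC ler_pdivrMr ?npow_gt0 // mul1r ler_nat.
  by case: (m) => [|k]; rewrite ?expn0 // leq_exp2r ?nl.
by rewrite -!pmulrn; ring.
Qed.

Definition cell_alone m p G := forall q g z,
  cell n X m q -> G g -> X z -> cmap n m p g = cmap n m q z -> q = p.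

(** A point of [X] near the copy lies in a cell [q] that, by [translate_gap], meets the copy. Hence
    [q = p], and the gap of [G] itself applies. *)
Lemma detached_cell m p e G l : (forall j, n j <= n l)%N ->
  detached e G X -> translate_gap e G -> 0 < e -> cell n X m p -> cell_alone m p G ->
  detached (e / (n l ^ m)%:R) (cmap n m p @` G) X.
Proof.
move=> nl iG gG e0 cp hp; split=> [_ [g Gg <-]|_ y [g Gg <-] Xy gy].
  by apply: (proj2 cp); exact: (proj1 iG).
have [q [z [cq Xz yE]]] := sa_cover sa m Xy; rewrite {y}yE in Xy gy *.
have gv := close_cmap nl e0 gy.
have [g' [z' [Gg' Xz' gz']]] := gG _ _ _ Gg Xz gv.
have qp : q = p by apply: (hp q g' z') => //; rewrite gz' cmap_translate.
exists z; last by rewrite qp.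
apply: (proj2 iG) Gg Xz _ => j; have := gv j.
by rewrite mxE qp subrr addr0.
Qed.

Lemma neighbor_coord m p q g z j : X g -> X z -> cmap n m p g = cmap n m q z ->
  [\/ q j = p j, q j = (p j).+1 /\ g 0 j = 1 | p j = (q j).+1 /\ g 0 j = 0].
Proof.
move=> Xg Xz /cmap_eq/(_ j); apply: unit_shift_eq.
  exact: (sa_unit sa j Xg).
exact: (sa_unit sa j Xz).
Qed.

Lemma touches_cell m p G a b : (p a < n a ^ m)%N -> G `<=` X ->
  touches (cmap n m p @` G) a b ->
  touches G a b /\ p a = (if b then (n a ^ m).-1 else 0%N).
Proof.
move=> hpa GX [_ [g Gg <-]]; rewrite mxE.
move=> /(canRL (divfK (lt0r_neq0 (npow_gt0 a m)))) hE.
have g01 := sa_unit sa a (GX _ Gg).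
case: b hE => hE.
  have h1 : (p a)%:R + 1 <= (n a ^ m)%:R :> R by rewrite natr1 ler_nat.
  split; first by exists g => //; move: hE; rewrite mul1r /=; lra.
  have /eqP : (p a).+1%:R = (n a ^ m)%:R :> R.
    by rewrite -natr1; move: hE; rewrite mul1r; lra.
  by rewrite eqr_nat => /eqP <-.
have h1 : 0 <= (p a)%:R :> R by [].
split; first by exists g => //; move: hE; rewrite mul0r /=; lra.
by apply/eqP; rewrite -(pnatr_eq0 R); apply/eqP; move: hE; rewrite mul0r; lra.
Qed.

Lemma island_cell_alone m p G : G `<=` X -> (forall a b, ~ touches G a b) ->
  cell_alone m p G.
Proof.
move=> GX hG q g z cq Gg Xz gz; apply/funext => j.
have [//|[_ g1]|[_ g0]] := neighbor_coord j (GX _ Gg) Xz gz.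
  by case: (hG j true); exists g.
by case: (hG j false); exists g.
Qed.

Lemma island_cell m p e G l : (forall j, n j <= n l)%N -> 0 < e ->
  detached e G X -> translate_gap e G -> (forall a b, ~ touches G a b) ->
  cell n X m p -> detached (e / (n l ^ m)%:R) (cmap n m p @` G) X.
Proof.
move=> nl e0 iG gG tG cp; apply: detached_cell => //.
by apply: island_cell_alone => //; exact: (proj1 iG).
Qed.

(** The island contains a cell and hence the fixed point of that cell, around which copies of the
    island shrink to a point. *)
Lemma island_trivial_point l : (forall j, n j <= n l)%N -> island X ->
  has_trivial_point X.
Proof.
move=> nl [e0 [G [e00 iG0 [z Gz] tG]]].
have [e [epos iG gG]] := translate_gap_exists e00 iG0.
have [m [p [m0 cp hp]]] := detached_has_cell epos iG Gz.
have [y Xy fy] := cell_fixpoint m0 cp.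
have Gy : G y by rewrite -fy; exact: hp.
exists y; apply: detached_trivial_point => // eta eta0.
have [t ht] := pow_small eta0.
have [q cq fq] := cell_iter cp fy t.
exists (e / (n l ^ (t * m))%:R), (cmap n (t * m) q @` G); split.
- by rewrite divr_gt0 ?npow_gt0.
- exact: island_cell.
- by exists y.
- move=> _ [g Gg <-] j; rewrite -{1}fq.
  apply: le_lt_trans (cell_dist _ _ _ Xy (proj1 iG _ Gg)) (ht _ _ (sa_ge2 sa j) _).
  by rewrite leq_pmulr.
Qed.

End SelfAffineSets.

(** * Islands avoiding the faces of the cube *)

Section FaceReduction.
Context {R : realType} {d : nat} (n : 'I_d -> nat) (X : set 'rV[R]_d).
Hypothesis sa : self_affine n X.
Implicit Types (G H : set 'rV[R]_d) (p q : 'I_d -> nat).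

(* The position obtained from p by moving to the side of every face touched by
   G; meaningful when G never touches two opposite faces. *)
Definition push G m p : 'I_d -> nat := fun a =>
  if `[<touches G a true>] then (n a ^ m).-1
  else if `[<touches G a false>] then 0%N else p a.

Definition face_count G := #|[set ab : 'I_d * bool | `[<touches G ab.1 ab.2>]]|%SET.

(** Total number of unit steps from [p] to its push; the induction measure of [push_cell]. *)
Definition face_gap G m p :=
  (\sum_a (if `[<touches G a true>] then (n a ^ m).-1 - p a
           else if `[<touches G a false>] then p a else 0))%N.

Definition linked G m p q := exists g z, [/\ G g, X z & cmap n m p g = cmap n m q z].

Lemma push_idem G m p : push G m (push G m p) = push G m p.
Proof. by apply/funext => a; rewrite /push; do 2 case: asboolP => //. Qed.

(** A composed index is extreme exactly when it is extreme at both levels. *)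
Lemma push_pcomp G m m' p p' : (forall j, p j < n j ^ m)%N ->
  push G (m + m') (pcomp n m' p p') = pcomp n m' (push G m p) (push G m' p').
Proof.
move=> hp; apply/funext => a; rewrite /push /pcomp expnD.
have : (0 < n a ^ m)%N by apply: leq_ltn_trans (hp a).
have : (0 < n a ^ m')%N by rewrite expn_gt0; have := sa_ge2 sa a; lia.
by case: (asboolP (touches G a true)) => _; [nia|case: (asboolP (touches G a false)) => _; nia].
Qed.

(** * Contradiction when no cylinder reduces the set of touched faces *)

Section Stuck.
Variables (G : set 'rV[R]_d) (e : R) (l : 'I_d).
Hypotheses (nl : forall j, (n j <= n l)%N) (e0 : 0 < e) (iG : detached e G X).
Hypotheses (gG : translate_gap X e G) (G0 : G !=set0).
Hypothesis opp : forall a, ~ (touches G a false /\ touches G a true).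
Hypothesis stuck : forall m p, cell n X m p -> push G m p <> p ->
  exists2 q, cell n X m q /\ q <> p & linked G m p q.

Lemma linked_coord m p q : linked G m p q -> forall a,
  [\/ q a = p a, q a = (p a).+1 /\ touches G a true
    | p a = (q a).+1 /\ touches G a false].
Proof.
move=> [g [z [Gg Xz gz]]] a.
have [h|[h ga]|[h ga]] := neighbor_coord sa a (proj1 iG _ Gg) Xz gz.
- exact: Or31.
- by apply: Or32; split=> //; exists g.
- by apply: Or33; split=> //; exists g.
Qed.

Lemma push_coord_linked m p q : cell n X m q -> linked G m p q ->
  push G m q = push G m p.
Proof.
move=> cq hl; apply/funext => a; rewrite /push.
case: (asboolP (touches G a true)) => // t1; case: (asboolP (touches G a false)) => // t2.
by have [|[_ /t1]|[_ /t2]] := linked_coord hl a.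
Qed.

Lemma face_gap_linked m p q : cell n X m p -> cell n X m q -> q <> p ->
  linked G m p q -> (face_gap G m q < face_gap G m p)%N.
Proof.
move=> [hp _] [hq _] qp hl.
have [a qpa] : exists a, q a <> p a by apply/existsNP => h; apply/qp/funext.
rewrite /face_gap (bigD1 a) //= [ltnRHS](bigD1 a) //= -addSn; apply: leq_add.
  have := hp a; have := hq a; have := opp (a := a).
  have [//|[-> ha]|[-> ha]] := linked_coord hl a.
    by rewrite asboolT //; lia.
  by case: ifP => [/asboolP hb [] //|_ _]; rewrite asboolT.
apply: leq_sum => b _.
have := hp b; have := hq b; have := opp (a := b).
have [-> //|[-> ha]|[-> ha]] := linked_coord hl b.
  by rewrite asboolT //; lia.
by case: ifP => [/asboolP hb [] //|_ _]; rewrite asboolT.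
Qed.

(** Links only lead towards the touched faces and lower [face_gap], so they chain [p] to its push.
    Linked cells share a point, and a cell smaller than the gap of [H] is never cut by [H], so the
    whole chain is inside [H] or none of it is. *)
Lemma push_cell m H eH : detached eH H X -> (forall j, (n j ^ m)%:R^-1 < eH) ->
  forall p, cell n X m p -> cell n X m (push G m p) /\
   ((forall z, X z -> H (cmap n m p z)) <->
    (forall z, X z -> H (cmap n m (push G m p) z))).
Proof.
move=> iH small p; have [k] := ubnP (face_gap G m p).
elim: k p => // k IH p hk cp.
have [pp|pp] := pselect (push G m p = p); first by rewrite pp.
have [q [cq qp] hl] := stuck cp pp.
have [|h1 h2] := IH q _ cq.
  by have := face_gap_linked cp cq qp hl; lia.
rewrite -(push_coord_linked cq hl); split=> //; apply: iff_trans h2.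
have [g [z [Gg Xz gz]]] := hl.
have Xg := proj1 iG _ Gg.
split=> hH.
  by apply: (cell_in_detached sa small iH cq Xz); rewrite -gz; exact: hH.
by apply: (cell_in_detached sa small iH cp Xg); rewrite gz; exact: hH.
Qed.

(** A neighbour met by the copy would lie beyond a touched face, outside the grid. *)
Lemma push_alone m p : cell_alone n X m (push G m p) G.
Proof.
move=> q g z [hq _] Gg Xz gz; apply/funext => a.
have hl : linked G m (push G m p) q by exists g, z.
have [//|[qa t]|[pa t]] := linked_coord hl a.
  by have := hq a; move: qa; rewrite /push asboolT //; lia.
move: pa; rewrite /push; case: ifP => [/asboolP t'|_]; first by case: (opp (a := a)).
by rewrite asboolT.
Qed.

(* If x lies in the cell i with i off the touched face a, then the copy of G in
   push i contains a cell push (i p), hence also the cell i (push p), which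
   contradicts the a-th coordinate. *)
Lemma stuck_false a b x : touches G a b -> X x -> x 0 a != b%:R -> False.
Proof.
move=> tab Xx xb.
have xb0 : 0 < `|x 0 a - b%:R| by rewrite normr_gt0 subr_eq0.
have [m0 hm0] := pow_small xb0.
have [i [w [ci Xw xE]]] := sa_cover sa m0 Xx.
pose i' := push G m0 i.
have npos j m : (0 < n j ^ m)%N by rewrite expn_gt0; have := sa_ge2 sa j; lia.
have small0 j : (n j ^ m0)%:R^-1 < 2 :> R.
  by apply: (@le_lt_trans _ _ 1); rewrite ?ltr1n // invf_le1 ?(npow_gt0 sa) ?(npow_ge1 sa).
(* Taking [H = X] with gap 2, larger than any side, yields just that [i'] is a cell. *)
have [ci' _] := push_cell (detached_self _ _) small0 ci.
have iH := detached_cell sa nl iG gG e0 ci' (@push_alone m0 i).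
set H := cmap n m0 i' @` G in iH; set eH := e / _ in iH.
have eH0 : 0 < eH by rewrite divr_gt0 // (npow_gt0 sa).
have [m1 hm1] := pow_small eH0; have [m2 hm2] := pow_small e0.
pose m := maxn m1 m2.
have [z Gz] := G0.
have [p [z1 [cp Xz1 zE]]] := sa_cover sa m (proj1 iG _ Gz).
have small2 j : (n j ^ m)%:R^-1 < e.
  by apply: hm2; [exact: sa_ge2 sa j|exact: leq_maxr].
have [cp' [hp' _]] := push_cell iG small2 cp.
have Gp' := hp' (cell_in_detached sa small2 iG cp Xz1 (eq_ind _ _ Gz _ zE)).
set p' := push G m p in cp' Gp'.
have small1 j : (n j ^ (m0 + m))%:R^-1 < eH.
  by apply: hm1; [exact: sa_ge2 sa j|rewrite (leq_trans (leq_maxl m1 m2)) ?leq_addl].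
(* The push of [pcomp n m i p'] is [pcomp n m i' p'], which lies in [H]; so [H] also contains the
   unpushed cell, a part of the cell [i]. *)
have [_ [_ hr]] := push_cell iH small1 (cell_comp sa ci cp').
have [g Gg gE] : H (cmap n (m0 + m) (pcomp n m i p') w).
  apply: hr => // y Xy; rewrite push_pcomp; last exact: (proj1 ci).
  by rewrite push_idem -(cmap_comp sa); exists (cmap n m p' y) => //; exact: Gp'.
move: gE; rewrite -(cmap_comp sa) => gE.
have Xpw := proj2 cp' _ Xw.
have hl : linked G m0 i' i by exists g, (cmap n m p' w).
(* A link from [i'] can only step further towards the face, where [i'] is already extreme. *)
have ia : i a = i' a.
  have [//|[iE t]|[iE t]] := linked_coord hl a.
    have := proj1 ci a; rewrite iE /i' /push asboolT //.
    by have := npos a m0; lia.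
  move: iE; rewrite /i' /push; case: ifP => [/asboolP t'|_].
    by case: (opp (a := a)).
  by rewrite asboolT.
(* The cell [i] thus borders the face, whereas [m0] makes its side shorter than the distance from
   [x] to the face. *)
suff : `|x 0 a - b%:R| <= (n a ^ m0)%:R^-1.
  by have := hm0 (n a) m0 (sa_ge2 sa a) (leqnn _); lra.
have := sa_unit sa a Xw; move: ia.
have N0 := npow_gt0 sa a m0.
have N1 : (n a ^ m0)%:R != 0 :> R by rewrite gt_eqF.
rewrite xE mxE /i' /push; case: b tab {xb xb0 hm0} => tab.
  rewrite asboolT // => -> w01.
  rewrite (_ : _ - _ = (w 0 a - 1) / (n a ^ m0)%:R).
    rewrite normrM normfV [`|_%:R|]ger0_norm // -[leRHS]mul1r.
    by rewrite ler_pM2r ?invr_gt0 // ler_norml; lra.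
  have -> : ((n a ^ m0).-1)%:R = (n a ^ m0)%:R - 1 :> R.
    by rewrite -subn1 natrB.
  by rewrite (_ : true%:R = 1 :> R) //; field.
case: ifP => [/asboolP t|_]; first by case: (opp (a := a)).
rewrite asboolT // => -> w01; rewrite addr0 subr0.
rewrite normrM normfV [`|_%:R|]ger0_norm // -[leRHS]mul1r.
by rewrite ler_pM2r ?invr_gt0 // ler_norml; lra.
Qed.

End Stuck.

(** Induction on the number of touched faces: a copy of [G] alone in a cell that differs from its
    push is again detached and touches fewer faces. Without such a cell, [stuck_false] applies to a
    point off a touched face. *)
Lemma island_exists l e G : (forall j, n j <= n l)%N ->
  (forall a (b : bool), exists2 x, X x & x 0 a != b%:R) ->
  0 < e -> detached e G X -> G !=set0 ->
  (forall a, ~ (touches G a false /\ touches G a true)) -> island X.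
Proof.
move=> nl nd; have [k] := ubnP (face_count G).
elim: k e G => // k IH e1 G hk e10 iG1 G0 opp.
have [e [e0 iG gG]] := translate_gap_exists sa e10 iG1.
have [[a [b tab]]|no] := pselect (exists a b, touches G a b); last first.
  by exists e, G; split=> // a b tab; apply: no; exists a, b.
have [[m [p [cp pp ap]]]|st] :=
  pselect (exists m p, [/\ cell n X m p, push G m p <> p & cell_alone n X m p G]).
  have tsub a' b' : touches (cmap n m p @` G) a' b' ->
      touches G a' b' /\ push G m p a' = p a'.
    move=> /(touches_cell sa (proj1 cp a') (proj1 iG))[t ->]; split=> //.
    rewrite /push; case: b' t => t; first by rewrite asboolT.
    by case: ifP => [/asboolP t'|_]; [case: (opp a')|rewrite asboolT].
  apply: (IH (e / (n l ^ m)%:R) (cmap n m p @` G)).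
  - move: hk; rewrite ltnS; apply: leq_trans; apply: proper_card; apply/properP; split.
      by apply/fintype.subsetP => -[a' b']; rewrite !inE /= => /tsub[].
    (* A coordinate changed by the push supplies the face that is lost. *)
    have [a' pa'] : exists a', push G m p a' <> p a'.
      by apply/existsNP => h; apply/pp/funext.
    have [b' tb'] : exists b', touches G a' b'.
      move: pa'; rewrite /push; case: ifP => [/asboolP t _|_]; first by exists true.
      by case: ifP => [/asboolP t _|//]; exists false.
    exists (a', b'); first by rewrite !inE /=.
    by apply/negP; rewrite !inE /= => t; exact: pa' (proj2 (tsub _ _ t)).
  - by rewrite divr_gt0 // (npow_gt0 sa).
  - exact: detached_cell.
  - by have [g Gg] := G0; exists (cmap n m p g); exists g.
  - by move=> a' [t1 t2]; apply: (opp a'); split; [exact: (proj1 (tsub _ _ t1))|exact: (proj1 (tsub _ _ t2))].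
have [x Xx xb] := nd a b.
exfalso; apply: (stuck_false nl e0 iG gG G0 opp _ tab Xx xb) => m p cp pp.
apply: contrapT => hq; apply: st; exists m, p; split=> // q g z cq Gg Xz gz.
by apply: contrapT => qp; apply: hq; exists q => //; exists g, z.
Qed.

Lemma small_island l e G : (forall j, n j <= n l)%N ->
  (forall a (b : bool), exists2 x, X x & x 0 a != b%:R) ->
  0 < e -> detached e G X -> G !=set0 ->
  (forall x y a, G x -> G y -> `|x 0 a - y 0 a| < 1) -> island X.
Proof.
move=> nl nd e0 iG G0 hG; apply: island_exists nl nd e0 iG G0 _.
move=> a [[x Gx x0] [y Gy y1]]; have := hG x y a Gx Gy.
by rewrite x0 y1 sub0r normrN normr1 ltxx.
Qed.

Lemma trivial_point_island l : (forall j, n j <= n l)%N ->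
  (forall a (b : bool), exists2 x, X x & x 0 a != b%:R) ->
  has_trivial_point X -> island X.
Proof.
move=> nl nd [z tz]; have h0 : (0 : R) < 1 / 2 by [].
have [e [G [e0 iG Gz hG]]] := trivial_point_detached (sa_compact sa) tz h0.
apply: (small_island nl nd e0 iG); first by exists z.
move=> x y a Gx Gy; have := closeD (close_sym (hG _ Gx)) (hG _ Gy).
by move=> /(_ a) h; apply: lt_le_trans h _; lra.
Qed.

End FaceReduction.

(** * Uniformly trivial points *)

Definition uniformly_trivial (R : realType) (d : nat) (C : R)
    (X : set 'rV[R]_d) (y : 'rV[R]_d) :=
  forall delta, 0 < delta -> exists G, [/\ detached delta G X, G y &
    forall g, G g -> forall j, `|g 0 j - y 0 j| <= C * delta].

(** Used for the last coordinate of a projection, the most contracted one. *)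
Definition trivial_along (R : realType) (d : nat) (l : 'I_d) (C : R)
    (X : set 'rV[R]_d) (y : 'rV[R]_d) :=
  forall delta, 0 < delta -> exists G, [/\ detached delta G X, G y &
    forall g, G g -> `|g 0 l - y 0 l| <= C * delta].

Section Scales.
Context {R : realType} {d : nat} (n : 'I_d -> nat) (X : set 'rV[R]_d).
Hypothesis sa : self_affine n X.
Variable l : 'I_d.
Hypothesis nl : forall j, (n j <= n l)%N.
Implicit Types (y : 'rV[R]_d) (e : R) (G : set 'rV[R]_d) (p : 'I_d -> nat).

(** Any [delta] below [e] lies between two consecutive scales, which costs a factor [n l ^ M]. *)
Lemma trivial_along_scales M e y : (0 < M)%N -> 0 < e -> X y ->
  (forall t, exists G, [/\ detached (e / (n l ^ (t * M))%:R) G X, G y &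
     forall g, G g -> `|g 0 l - y 0 l| <= (n l ^ (t * M))%:R^-1]) ->
  trivial_along l ((n l ^ M)%:R / e) X y.
Proof.
move=> M0 e0 Xy hG delta delta0.
have NM := npow_ge1 sa l M.
have ub : exists t, e / (n l ^ (t * M))%:R < delta.
  have [m hm] : exists m, forall N m', (2 <= N)%N -> (m <= m')%N ->
      (N ^ m')%:R^-1 < delta / e by apply: pow_small; rewrite divr_gt0.
  exists m; have := hm (n l) (m * M)%N (sa_ge2 sa l) (leq_pmulr _ M0).
  by rewrite ltr_pdivlMr // mulrC.
(* If the least exponent is 0, then [delta] exceeds [e] and all of [X] is small enough. *)
case: (ex_minnP ub) => -[|t] ht tmin.
  exists X; split=> // [|g Xg]; first exact: detached_self.
  apply: le_trans (unit_dist sa l Xg Xy) _.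
  move: ht; rewrite mul0n expn0 divr1 => ht.
  rewrite mulrAC ler_pdivlMr // mul1r; apply: le_trans (ltW ht) _.
  by rewrite -[leLHS]mul1r ler_pM2r.
have {tmin} ht' : delta <= e / (n l ^ (t * M))%:R.
  by rewrite leNgt; apply/negP => /tmin; rewrite ltnn.
have [G [iG Gy hGy]] := hG t; exists G; split=> //.
  exact: detached_le iG.
move=> g /hGy h; apply: le_trans h _.
move: ht; rewrite mulSn expnD natrM ltr_pdivrMr ?mulr_gt0 ?(npow_gt0 sa) // => ht.
rewrite mulrAC ler_pdivlMr // mulrC ler_pdivrMr ?(npow_gt0 sa) //.
by apply: le_trans (ltW ht) _; rewrite mulrC mulrAC.
Qed.

(** The cells of rank [t * M] fixing [y] carry copies of the island, with gaps comparable to their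
    shortest side. *)
Lemma island_trivial_along M p e G y : (0 < M)%N -> cell n X M p ->
  cmap n M p y = y -> 0 < e -> detached e G X -> G y ->
  (forall a b, ~ touches G a b) -> exists2 C, 0 <= C & trivial_along l C X y.
Proof.
move=> M0 cp fy e10 iG1 Gy tG.
have [e' [e0 iG gG]] := translate_gap_exists sa e10 iG1.
have Xy := proj1 iG _ Gy.
exists ((n l ^ M)%:R / e'); first by rewrite divr_ge0 // ltW.
apply: trivial_along_scales => // t.
have [q cq fq] := cell_iter sa cp fy t.
exists (cmap n (t * M) q @` G); split; first exact: island_cell.
  by exists y.
move=> _ [g Gg <-]; rewrite -{1}fq; apply: (cell_dist sa) => //.
exact: (proj1 iG).
Qed.

End Scales.

(** * Uniform gaps in totally disconnected sets *)

Section TotallyDetached.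
Context {R : realType} {d : nat}.
Implicit Types (A B X : set 'rV[R]_d) (x y z : 'rV[R]_d).

Definition totally_detached A := forall eta : R, 0 < eta ->
  exists2 e, 0 < e & forall x, A x ->
    exists G, [/\ detached e G A, G x & G `<=` close eta x].

Lemma totally_disconnected_detached X :
  compact X -> totally_disconnected X -> totally_detached X.
Proof.
move=> cX tX eta eta0.
have [e e0 he] : exists2 e, 0 < e & forall x, X x -> X x ->
    exists G, [/\ detached e G X, G x & G `<=` close eta x].
  apply: (compact_uniform (P := fun e x => X x ->
    exists G, [/\ detached e G X, G x & G `<=` close eta x])) => // x Xx.
  have h2 : 0 < eta / 2 by rewrite divr_gt0.
  have [e [G [e0 iG Gx hG]]] :=
    trivial_point_detached cX (conj Xx (tX x Xx)) h2.
  exists (Num.min (eta / 2) e) => [|e' x' /andP[e'0]]; first by rewrite lt_min h2.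
  rewrite le_min => /andP[l1 l2] xx' Xx'; exists G; split.
  - exact: detached_le iG.
  - by apply: (proj2 iG) Gx Xx' (close_le _ xx'); rewrite ge_min lexx orbT.
  - move=> g /hG xg; apply: close_le (closeD (close_sym xx') xg).
    have : Num.min (eta / 2) e <= eta / 2 by rewrite ge_min lexx.
    lra.
by exists e => // x Xx; exact: he.
Qed.

Lemma totally_detachedU_left A B : totally_detached A -> totally_detached B ->
  forall eta : R, 0 < eta -> exists2 e, 0 < e & forall x, A x ->
    exists G, [/\ detached e G (A `|` B), G x & G `<=` close eta x].
Proof.
move=> tA tB eta eta0.
have [|e1 e10 h1] := tA (eta / 2); first by rewrite divr_gt0.
(* Four steps must not exceed the gap [e1] of [A], and three steps added to [eta / 2] must not
   exceed [eta]. *)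
pose r := Num.min (e1 / 4) (eta / 6).
have r0 : 0 < r by rewrite lt_min !divr_gt0.
have r1 : r <= e1 / 4 by rewrite ge_min lexx.
have r2 : r <= eta / 6 by rewrite ge_min lexx orbT.
have [e2 e20 h2] := tB r r0.
exists (Num.min e2 r) => [|x Ax]; first by rewrite lt_min e20.
have [GA [iA Ax' hGA]] := h1 x Ax.
(* A piece GA of A is completed by the pieces of B passing near it: these are so
   small that they cannot bridge the gap around GA. *)
pose W := [set b | B b /\ exists H c, [/\ detached e2 H B, H b, H `<=` close r c &
  exists h a, [/\ H h, GA a & close r h a]]].
have le1 : Num.min e2 r <= e2 by rewrite ge_min lexx.
have le2 : Num.min e2 r <= r by rewrite ge_min lexx orbT.
exists (GA `|` W); split; [|by left|].
  split=> [y [/(proj1 iA)|[]]|g y Gg ABy gy]; [by left|by right|].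
  have [Gg'|[Bg [H [c [iH Hg Hc [h [a [Hh GAa ha]]]]]]]] := Gg.
    have [Ay|By] := ABy.
      left; apply: (proj2 iA) Gg' Ay (close_le _ gy).
      by apply: le_trans le2 _; lra.
    right; split=> //; have [H [iH Hy hH]] := h2 y By.
    exists H, y; split=> //; exists y, g; split=> //.
    exact: close_le le2 (close_sym gy).
  have [Ay|By] := ABy; last first.
    right; split=> //; exists H, c; split=> //; last by exists h, a.
    exact: (proj2 iH) Hg By (close_le le1 gy).
  left; apply: (proj2 iA) GAa Ay _.
  apply: close_le (closeD (closeD (closeD (close_sym ha) (close_sym (Hc _ Hh)))
    (Hc _ Hg)) (close_le le2 gy)); lra.
move=> g [/hGA|[Bg [H [c [iH Hg Hc [h [a [Hh GAa ha]]]]]]]].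
  by apply: close_le; lra.
apply: close_le (closeD (closeD (closeD (hGA _ GAa) (close_sym ha))
  (close_sym (Hc _ Hh))) (Hc _ Hg)); lra.
Qed.

Lemma totally_detachedU A B : totally_detached A -> totally_detached B ->
  totally_detached (A `|` B).
Proof.
move=> tA tB eta eta0.
have [e1 e10 h1] := totally_detachedU_left tA tB eta0.
have [e2 e20 h2] := totally_detachedU_left tB tA eta0.
exists (Num.min e1 e2) => [|x]; first by rewrite lt_min e10.
case=> [/h1|/h2] [G [iG Gx hG]]; exists G; split=> //.
  by apply: detached_le iG; rewrite ge_min lexx.
by rewrite setUC; apply: detached_le iG; rewrite ge_min lexx orbT.
Qed.

Lemma totally_detached_translate v X : totally_detached X ->
  totally_detached (translate v @` X).
Proof.
have tE e x y : close e (translate v x) (translate v y) <-> close e x y.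
  by split=> h j; move: (h j); rewrite !mxE opprD addrACA subrr addr0.
move=> tX eta /tX[e e0 he]; exists e => // _ [x Xx <-].
have [G [iG Gx hG]] := he x Xx; exists (translate v @` G); split.
- split=> [_ [g /(proj1 iG) Xg <-]|_ _ [g Gg <-] [y Xy <-] /tE gy]; first by exists g.
  by exists y => //; exact: (proj2 iG) Gg Xy gy.
- by exists x.
- by move=> _ [g /hG xg <-]; apply/tE.
Qed.

Lemma totally_detached_bigU (I : eqType) (s : seq I) (F : I -> set 'rV[R]_d) :
  (forall i, totally_detached (F i)) ->
  totally_detached [set x | exists2 i, i \in s & F i x].
Proof.
move=> tF; elim: s => [|i s IH].
  by move=> eta eta0; exists 1 => // x [].
rewrite (_ : [set x | _] = F i `|` [set x | exists2 i, i \in s & F i x]).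
  exact: totally_detachedU.
apply/seteqP; split=> x /= [].
- by move=> k; rewrite inE => /predU1P[->|ks Fx]; [left|right; exists k].
- by exists i => //; rewrite inE eqxx.
- by move=> [k ks Fx]; exists k => //; rewrite inE ks orbT.
Qed.

(** Adjacent cells may meet, so small pieces are taken in the union [B] of the translates of [X] by
    vectors with entries -1, 0, 1. It is still totally detached, and contains all that is near a
    piece of a rescaled cell. *)
Lemma totally_detached_trivial_along (n : 'I_d -> nat) X (l : 'I_d) :
  self_affine n X -> (forall j, n j <= n l)%N -> totally_detached X ->
  exists2 C : R, 0 <= C & forall y, X y -> trivial_along l C X y.
Proof.
move=> sa nl tX.
pose B := [set x | exists2 f, f \in enum {ffun 'I_d -> 'I_3} &
                     (translate (shift3 f) @` X) x].
have inB v z : X z -> (forall j, `|(v j)%:~R : R| < 2) -> B (translate v z).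
  move=> Xz /shift3_surj[f ->]; exists f; first exact: mem_enum.
  by exists z.
have tB : totally_detached B.
  by apply: totally_detached_bigU => f; exact: totally_detached_translate.
have [|e1 e10 he1] := tB (1 / 2); first by [].
pose e := Num.min e1 (1 / 2).
have e0 : 0 < e by rewrite lt_min e10 /=.
have le1 : e <= e1 by rewrite ge_min lexx.
have le2 : e <= 1 / 2 by rewrite ge_min lexx orbT.
exists ((n l ^ 1)%:R / e); first by rewrite divr_ge0 // ltW.
move=> y Xy; apply: (trivial_along_scales sa) => // t.
have [p [z [cp Xz yE]]] := sa_cover sa (t * 1) Xy.
have Bz : B z.
  have -> : z = translate (fun=> 0) z by apply/rowP => j; rewrite mxE addr0.
  by apply: inB => // j; rewrite normr0.
have [G [iG Gz hG]] := he1 z Bz.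
exists (X `&` cmap n (t * 1) p @` G); split.
- split=> [x []//|x y' [_ [g Gg <-]] Xy' gy]; split=> //.
  have [q [z' [cq Xz' yE']]] := sa_cover sa (t * 1) Xy'.
  rewrite yE' in gy *; have h := close_cmap sa nl e0 gy.
  exists (translate (fun j => (q j)%:Z - (p j)%:Z) z'); last exact: cmap_translate.
  (* The translation is less than 2: at most 1 between [z] and [z'], and less than 1/2 each for the
     piece and the gap. *)
  apply: (proj2 iG _ _ Gg _ (close_le le1 h)); apply: inB => // j.
  have := h j; have := hG _ Gg j; have := unit_dist sa j Xz Xz'.
  rewrite mxE ler_norml !ltr_norml; move: ((_ - _)%:~R : R) => w; lra.
- by split=> //; exists z.
- move=> _ [_ [g Gg <-]]; rewrite yE cmap_dist_same.
  rewrite -[leRHS]mul1r ler_pM2r ?invr_gt0 ?(npow_gt0 sa) //.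
  have := hG _ Gg l; rewrite distrC; lra.
Qed.

End TotallyDetached.

(** * Projections and bi-Lipschitz maps *)

(** Unlike in [coord_proj], [j = d] is allowed, so that the set itself counts as its last
    projection. *)
Definition first_coords (R : realType) (d j : nat) (hj : (j <= d)%N)
    (x : 'rV[R]_d) : 'rV[R]_j := \row_k x 0 (widen_ord hj k).

Section Projections.
Context {R : realType} {d : nat} (n : 'I_d -> nat) (X : set 'rV[R]_d).
Hypothesis sa : self_affine n X.
Implicit Types (x y z : 'rV[R]_d) (e C : R) (p q : 'I_d -> nat).

Lemma close_first_coords j (hj : (j <= d)%N) e x y :
  close e x y -> close e (first_coords hj x) (first_coords hj y).
Proof. by move=> xy k; rewrite !mxE; exact: xy. Qed.

Lemma first_coords_cmap j (hj : (j <= d)%N) m p z :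
  first_coords hj (cmap n m p z) =
  cmap (n \o widen_ord hj) m (p \o widen_ord hj) (first_coords hj z).
Proof. by apply/rowP => k; rewrite !mxE. Qed.

Lemma cell_first_coords j (hj : (j <= d)%N) m p : cell n X m p ->
  cell (n \o widen_ord hj) (first_coords hj @` X) m (p \o widen_ord hj).
Proof.
move=> [hp cp]; split=> [k|_ [x Xx <-]]; first exact: hp.
by rewrite -first_coords_cmap; exists (cmap n m p x) => //; exact: cp.
Qed.

Lemma self_affine_first_coords j (hj : (j <= d)%N) :
  self_affine (n \o widen_ord hj) (first_coords hj @` X).
Proof.
split.
- by move=> k; exact: sa_ge2 sa _.
- by have [x Xx] := sa_neq0 sa; exists (first_coords hj x); exists x.
- apply: continuous_compact (sa_compact sa); apply: continuous_subspaceT.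
  move=> x A /nbhs_close[e e0 hA]; apply/nbhs_close; exists e => // y xy.
  by apply: hA; exact: close_first_coords.
- by move=> _ k [x Xx <-]; rewrite mxE; exact: (sa_unit sa).
- move=> m _ [x Xx <-]; have [p [z [cp Xz ->]]] := sa_cover sa m Xx.
  exists (p \o widen_ord hj), (first_coords hj z); split.
  + exact: cell_first_coords.
  + by exists z.
  + exact: first_coords_cmap.
Qed.

Lemma detached_first_coords j (hj : (j <= d)%N) e G :
  detached e G (first_coords hj @` X) ->
  detached e (X `&` first_coords hj @^-1` G) X.
Proof.
move=> [_ h]; split=> [x []//|x y [Xx Gx] Xy xy]; split=> //.
by apply: h Gx _ _; [exists y|exact: close_first_coords].
Qed.

Lemma first_coords_last (a : 'I_d) x :
  first_coords (ltn_ord a) x 0 ord_max = x 0 a.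
Proof. by rewrite mxE; congr (x 0 _); exact: val_inj. Qed.

(** Each coordinate [a] is the last one of some projection; the preimages of the parts found there
    are intersected. *)
Lemma uniformly_trivial_along (C : 'I_d -> R) y : (forall a, 0 <= C a) ->
  X y ->
  (forall a, trivial_along ord_max (C a) (first_coords (ltn_ord a) @` X)
                           (first_coords (ltn_ord a) y)) ->
  uniformly_trivial (\sum_a C a) X y.
Proof.
move=> C0 Xy h delta delta0.
have /choice[G hG] : forall a : 'I_d, exists G, [/\ detached delta G X, G y &
    forall g, G g -> `|g 0 a - y 0 a| <= C a * delta].
  move=> a; have [G [iG Gy hG]] := h a delta delta0.
  exists (X `&` first_coords (ltn_ord a) @^-1` G); split=> //.
    exact: detached_first_coords.
  by move=> g [_ /hG]; rewrite !first_coords_last.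
exists (X `&` [set x | forall a, G a x]); split.
- split=> [x []//|x x' [Xx Gx] Xx' xx']; split=> // a.
  by have [[_ iG] _ _] := hG a; exact: iG (Gx a) Xx' xx'.
- by split=> // a; have [] := hG a.
- move=> g [_ Gg] a; have [_ _ /(_ _ (Gg a))] := hG a.
  move=> /le_trans; apply; rewrite ler_pM2r //.
  by rewrite (bigD1 a) //= lerDl sumr_ge0.
Qed.

Hypothesis mono : forall j k : 'I_d, (j < k)%N -> (n j < n k)%N.

Lemma first_coords_mono j (hj : (j <= d)%N) (l : 'I_j) : j = l.+1 ->
  forall k, ((n \o widen_ord hj) k <= (n \o widen_ord hj) l)%N.
Proof.
move=> jl k; have := ltn_ord k; rewrite {2}jl ltnS leq_eqVlt => /predU1P[kl|kl].
  by rewrite (_ : k = l) //; exact: val_inj.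
by rewrite ltnW //; apply: mono.
Qed.

(* A common cell is found by refining: a cell inside the preimage of an island
   of the projection is composed with the cell already found, which carries
   that island to a smaller one. *)
Lemma islands_common_cell (s : seq 'I_d) :
  (forall a : 'I_d, island (first_coords (ltn_ord a) @` X)) ->
  exists m p, [/\ (0 < m)%N, cell n X m p & forall a, a \in s -> exists e G,
    [/\ 0 < e, detached e G (first_coords (ltn_ord a) @` X),
        forall i b, ~ touches G i b
      & forall x, X x -> G (first_coords (ltn_ord a) (cmap n m p x))]].
Proof.
move=> hI; elim: s => [|a s [m [p [m0 cp hs]]]].
  have [x Xx] := sa_neq0 sa; have [p [z [cp _ _]]] := sa_cover sa 1 Xx.
  by exists 1%N, p; split.
have [e1 [G [e10 iG1 [gz Gz] tG]]] := hI a.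
have [z Xz zE] := proj1 iG1 _ Gz; rewrite -{gz}zE in Gz.
have saa := self_affine_first_coords (ltn_ord a).
have [e [e0 iG gG]] := translate_gap_exists saa e10 iG1.
have [m' [p' [m'0 cp' hp']]] :=
  detached_has_cell sa e0 (detached_first_coords iG) (conj Xz Gz).
exists (m + m')%N, (pcomp n m' p p'); split.
- by rewrite addn_gt0 m0.
- exact: cell_comp.
- move=> b; rewrite inE => /predU1P[->|bs].
    exists (e / ((n \o widen_ord (ltn_ord a)) ord_max ^ m)%:R).
    exists (cmap (n \o widen_ord (ltn_ord a)) m (p \o widen_ord (ltn_ord a)) @` G).
    have cpa := cell_first_coords (ltn_ord a) cp.
    split.
    + by rewrite divr_gt0 // (npow_gt0 saa).
    + by apply: (island_cell saa) => //; exact: first_coords_mono.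
    + by move=> i b' /(touches_cell saa (proj1 cpa i) (proj1 iG))[t _]; exact: tG t.
    + move=> x Xx; rewrite -(cmap_comp sa) first_coords_cmap.
      by exists (first_coords (ltn_ord a) (cmap n m' p' x)) => //; exact: (hp' x Xx).2.
  have [e' [G' [e'0 iG' tG' hG']]] := hs b bs; exists e', G'; split=> // x Xx.
  by rewrite -(cmap_comp sa); apply: hG'; exact: (proj2 cp').
Qed.

(** The fixed point of a common cell projects into an island of every projection, and the cell fixes
    all these images. *)
Lemma islands_uniformly_trivial :
  (forall a : 'I_d, island (first_coords (ltn_ord a) @` X)) ->
  exists C y, [/\ 0 <= C, X y & uniformly_trivial C X y].
Proof.
move=> hI.
have [m [p [m0 cp hG]]] := islands_common_cell (enum 'I_d) hI.
have [y Xy fy] := cell_fixpoint sa m0 cp.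
have /choice[C hC] : forall a : 'I_d, exists C, 0 <= C /\
    trivial_along ord_max C (first_coords (ltn_ord a) @` X)
                            (first_coords (ltn_ord a) y).
  move=> a; have [e [G [e0 iG tG hGa]]] := hG a (mem_enum _ a).
  have [||C C0 hC] := island_trivial_along
    (self_affine_first_coords (ltn_ord a)) (first_coords_mono (ltn_ord a) (l := ord_max) erefl) m0
    (cell_first_coords (ltn_ord a) cp) _ e0 iG _ tG (y := first_coords (ltn_ord a) y).
  - by rewrite -first_coords_cmap fy.
  - by rewrite -fy; exact: hGa.
  - by exists C.
exists (\sum_a C a), y; split=> //.
  by apply: sumr_ge0 => a _; have [] := hC a.
by apply: uniformly_trivial_along => // a; have [] := hC a.
Qed.

Lemma totally_disconnected_uniformly_trivial :
  (forall a : 'I_d, totally_disconnected (first_coords (ltn_ord a) @` X)) ->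
  exists2 C, 0 <= C & forall y, X y -> uniformly_trivial C X y.
Proof.
move=> hT.
have /choice[C hC] : forall a : 'I_d, exists C, 0 <= C /\ forall y, X y ->
    trivial_along ord_max C (first_coords (ltn_ord a) @` X)
                            (first_coords (ltn_ord a) y).
  move=> a; have saa := self_affine_first_coords (ltn_ord a).
  have [C C0 hC] := totally_detached_trivial_along saa
    (first_coords_mono (ltn_ord a) (l := ord_max) erefl)
    (totally_disconnected_detached (sa_compact saa) (hT a)).
  by exists C; split=> // y Xy; apply: hC; exists y.
exists (\sum_a C a) => [|y Xy].
  by apply: sumr_ge0 => a _; have [] := hC a.
by apply: uniformly_trivial_along => // a; have [C0 h] := hC a => //; exact: h.
Qed.

Lemma uniformly_trivial_trivial_point C y : 0 <= C -> X y ->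
  uniformly_trivial C X y -> trivial_point X y.
Proof.
move=> C0 Xy hy; apply: detached_trivial_point => // eta eta0.
have d0 : 0 < eta / (C + 1) by rewrite divr_gt0 //; lra.
have [G [iG Gy hG]] := hy _ d0; exists (eta / (C + 1)), G; split=> // g Gg j.
rewrite distrC; apply: le_lt_trans (hG g Gg j) _.
by rewrite mulrA ltr_pdivrMr; nra.
Qed.

(** A Bernoulli-type bound giving explicit decay of [(a / N) ^ k]. *)
Lemma pow_ratio_small (a N k : nat) : (a < N)%N -> (k * a ^ k <= N * N ^ k)%N.
Proof.
move=> aN; suff h : (k * a ^ k <= a * N ^ k)%N.
  by apply: leq_trans h _; rewrite leq_mul2r ltnW ?orbT.
elim: k => // k IH; rewrite !expnS mulnCA leq_mul2l mulSnr; apply/orP; right.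
have h : (a ^ k <= N ^ k)%N by case: (k) => // i; rewrite leq_exp2r // ltnW.
apply: leq_trans (leq_add IH h) _.
by rewrite -mulSnr leq_mul2r aN orbT.
Qed.

(* At scale 2 (n l)^-k a cell of rank k looks like its projection on the first
   l coordinates, which are larger by the factors (n l / n i)^k. *)
Lemma uniformly_trivial_first_coords C (l : 'I_d) (eta : R) :
  0 <= C -> 0 < eta -> exists k, forall p x,
  cell n X k p -> X x -> uniformly_trivial C X (cmap n k p x) ->
  exists e G, [/\ 0 < e, detached e G (first_coords (ltnW (ltn_ord l)) @` X),
    G (first_coords (ltnW (ltn_ord l)) x)
    & G `<=` close eta (first_coords (ltnW (ltn_ord l)) x)].
Proof.
move=> C0 eta0.
(* By [pow_ratio_small], the rescaled size [C * (2 / n l ^ k) * n j ^ k] is at most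
   [2 * C * n l / k], hence below [eta]. *)
pose k := (Num.truncn (2 * C * (n l)%:R / eta)).+1.
have hk : 2 * C * (n l)%:R / eta < k%:R by exact: truncnS_gt.
exists k => p x cp Xx hx; set hl := ltnW (ltn_ord l).
have Nl0 := npow_gt0 sa l k.
have d0 : (0 : R) < 2 / (n l ^ k)%:R by rewrite divr_gt0.
have [G [iG Gx hG]] := hx _ d0.
exists (2 / (n l ^ k)%:R), [set z | exists2 w, X w &
  first_coords hl w = z /\ G (cmap n k p w)]; split=> //.
- split=> [_ [w Xw [<- _]]|_ _ [w Xw [<- Gw]] [w' Xw' <-] ww']; first by exists w.
  exists w' => //; split=> //; apply: (proj2 iG) Gw (proj2 cp _ Xw') _ => j.
  rewrite cmap_dist_same ltr_pdivrMr ?(npow_gt0 sa) //.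
  have [jl|lj] := ltnP j l.
    have := ww' (Ordinal jl); rewrite !mxE.
    have -> : widen_ord hl (Ordinal jl) = j by exact: val_inj.
    by move=> h; apply: lt_le_trans h _; rewrite ler_pMr // (npow_ge1 sa).
  (* From coordinate [l] on, a cell has sides at most [n l ^ -k]; the factor 2 in the scale makes
     the inequality strict. *)
  apply: le_lt_trans (unit_dist sa j Xw Xw') _.
  rewrite mulrAC ltr_pdivlMr // mul1r.
  have : (n l ^ k)%:R <= (n j ^ k)%:R :> R.
    rewrite ler_nat leq_exp2r //; move: lj; rewrite leq_eqVlt => /predU1P[lj|/mono/ltnW//].
    by rewrite (_ : l = j) //; exact: val_inj.
  lra.
- by exists x.
- move=> _ [w Xw [<- Gw]] i; rewrite !mxE; set j := widen_ord hl i.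
  have jl : (n j < n l)%N by apply: mono => /=; exact: ltn_ord.
  have := hG _ Gw j; rewrite cmap_dist_same ler_pdivrMr ?(npow_gt0 sa) // => h.
  rewrite distrC; apply: le_lt_trans h _.
  have k0 : (0 : R) < k%:R by rewrite ltr0n.
  have : k%:R * (n j ^ k)%:R <= (n l)%:R * (n l ^ k)%:R :> R.
    by rewrite -!natrM ler_nat pow_ratio_small.
  rewrite -ler_pdivlMl // => hr.
  apply: le_lt_trans (_ : _ <= C * (2 / (n l ^ k)%:R) * (k%:R^-1 * ((n l)%:R * (n l ^ k)%:R))) _.
    by apply: ler_wpM2l hr; rewrite mulr_ge0 // ltW.
  rewrite (_ : _ * _ = 2 * C * (n l)%:R / k%:R).
    by rewrite ltr_pdivrMr // (mulrC eta) -ltr_pdivrMr.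
  by field; rewrite !gt_eqF.
Qed.

Lemma first_coords_neq (j : nat) (hj : (j <= d)%N) :
  (forall a (b : bool), exists2 x, X x & x 0 a != b%:R) ->
  forall a (b : bool), exists2 x, (first_coords hj @` X) x & x 0 a != b%:R.
Proof.
move=> nd a b; have [x Xx xa] := nd (widen_ord hj a) b.
by exists (first_coords hj x); [exists x|rewrite mxE].
Qed.

End Projections.

(** * Euclidean distance and bi-Lipschitz invariance *)

Section EuclideanDistance.
Context {R : realType} {d : nat}.
Implicit Types x y : 'rV[R]_d.

Lemma coord_le_euclid x y j : `|x 0 j - y 0 j| <= euclid_dist x y.
Proof.
rewrite -sqrtr_sqr ler_wsqrtr // (bigD1 j) //= lerDl sumr_ge0 // => i _.
exact: sqr_ge0.
Qed.

Lemma euclid_le x y (r : R) : 0 <= r -> (forall j, `|x 0 j - y 0 j| <= r) ->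
  euclid_dist x y <= d%:R * r.
Proof.
move=> r0 h; have dr0 : 0 <= d%:R * r by rewrite mulr_ge0.
rewrite -[leRHS]ger0_norm // -sqrtr_sqr ler_wsqrtr //.
apply: (@le_trans _ _ (\sum_(j < d) r ^+ 2)).
  by apply: ler_sum => j _; rewrite -real_normK ?num_real // lerXn2r ?nnegrE.
rewrite sumr_const card_ord exprMn -[leLHS]mulr_natl ler_wpM2r ?sqr_ge0 //.
by rewrite -natrX ler_nat; case: (d) => // k; rewrite expnS expn1 leq_pmulr.
Qed.

(** The part of [E] is taken at scale [c * d.+1 * delta]: [c] from the lower Lipschitz bound, [d.+1]
    rather than [d] for strictness. The image costs another [c] and a factor [d]. *)
Lemma uniformly_trivial_bilipschitz (E E' : set 'rV[R]_d) f (c C : R) y :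
  set_bij E E' f -> 0 < c -> (forall x y, E x -> E y ->
    c^-1 * euclid_dist x y <= euclid_dist (f x) (f y) <= c * euclid_dist x y) ->
  0 <= C -> E y -> uniformly_trivial C E y ->
  uniformly_trivial (c * (d%:R * (C * (c * (d.+1)%:R)))) E' (f y).
Proof.
move=> [fE finj fsurj] c0 hf C0 Ey hy delta delta0.
have d1 : (0 : R) < d.+1%:R by rewrite ltr0n.
have e0 : 0 < c * d.+1%:R * delta by rewrite !mulr_gt0.
have [G [iG Gy hG]] := hy _ e0; exists (f @` G); split.
- split=> [_ [g /(proj1 iG) Eg <-]|_ y' [g Gg <-] E'y']; first exact: fE.
  have [x Ex <-] := fsurj _ E'y' => gx; exists x => //.
  apply: (proj2 iG _ _ Gg Ex) => j; apply: le_lt_trans (coord_le_euclid _ _ _) _.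
  have /andP[+ _] := hf _ _ (proj1 iG _ Gg) Ex.
  have := euclid_le (ltW delta0) (fun j => ltW (gx j)).
  move=> h1 /le_trans/(_ h1); rewrite ler_pdivrMl // => h2.
  apply: le_lt_trans h2 _; rewrite -mulrA ltr_pM2l // ltr_pM2r //.
  by rewrite ltr_nat.
- by exists y.
- move=> _ [g Gg <-] j; apply: le_trans (coord_le_euclid _ _ _) _.
  have /andP[_ h] := hf _ _ (proj1 iG _ Gg) Ey; apply: le_trans h _.
  rewrite -mulrA ler_pM2l // -mulrA; apply: euclid_le => [|i].
    by rewrite !mulr_ge0 // ltW.
  by rewrite -mulrA; exact: hG.
Qed.

End EuclideanDistance.

(** * Sponges as self-affine sets *)

Section Sponges.
Context {R : realType} {d : nat}.
Implicit Types E : set 'rV[R]_d.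

(** As all bases are at least 2, each application of the maps halves the excess of the bounded set
    [E] over the unit interval. *)
Lemma sponge_unit (n : 'I_d -> nat) (D : {set digit n}) E x j :
  (forall j, 2 <= n j)%N -> is_sponge_of D E -> E x -> 0 <= x 0 j <= 1.
Proof.
move=> n2 [_ cE ED] Ex.
have [B B0 hB] : exists2 B : R, 0 < B & forall x, E x -> `|x 0 j| <= B.
  have [B [Breal hB]] := compact_bounded cE.
  exists (`|B| + 1) => [|y Ey]; first by rewrite ltr_pwDr.
  apply: le_trans (hB (`|B| + 1) _ y Ey); last by rewrite ltr_pwDr // ler_norm.
  rewrite [leRHS]mx_normrE.
  exact: (le_bigmax _ (fun ij => `|y ij.1 ij.2|) (0, j)).
have Nj : (2 : R) <= (n j)%:R by rewrite ler_nat.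
have key t : forall x, E x -> - (B / 2 ^+ t) <= x 0 j <= 1 + B / 2 ^+ t.
  elim: t => [y Ey|t IH y].
    by rewrite expr0 divr1; have := hB y Ey; rewrite ler_norml; lra.
  rewrite {1}ED => -[i _ [z /IH/andP[z1 z2] <-]]; rewrite mxE.
  have i0 : (0 : R) <= (i j)%:R by [].
  have i1 : ((i j)%:R : R) + 1 <= (n j)%:R by rewrite natr1 ler_nat.
  have q0 : 0 <= B / 2 ^+ t by rewrite divr_ge0 ?exprn_ge0 // ltW.
  rewrite exprS invfM mulrCA mulrC; set q := B / 2 ^+ t in z1 z2 q0 *.
  rewrite ler_pdivlMr ?ler_pdivrMr; try lra.
  by apply/andP; split; nra.
have small (e : R) : 0 < e -> exists t, B / 2 ^+ t < e.
  move=> e0; have [m /(_ 2%N m isT (leqnn _))] := pow_small (divr_gt0 e0 B0).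
  by rewrite natrX => h; exists m; rewrite mulrC -ltr_pdivlMr.
apply/andP; split; rewrite leNgt; apply/negP => h.
  have [t ht] : exists t, B / 2 ^+ t < - x 0 j by apply: small; lra.
  by have := key t x Ex; lra.
have [t ht] : exists t, B / 2 ^+ t < x 0 j - 1 by apply: small; lra.
by have := key t x Ex; lra.
Qed.

(** In each coordinate, the digits of a word form the base [n j] expansion of its position. *)
Lemma sponge_self_affine E : sierpinski_sponge E ->
  exists2 n, self_affine n E & forall j k : 'I_d, (j < k)%N -> (n j < n k)%N.
Proof.
move=> [n [D [n2 mono _ hE]]]; exists n => //; have [E0 cE ED] := hE.
split=> // [x j|m]; first exact: sponge_unit hE.
elim: m => [x Ex|m IH x].
  exists (fun=> 0%N), x; rewrite cmap0; split=> //.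
  by split=> [j|z]; rewrite ?expn0 // cmap0.
rewrite {1}ED => -[i iD [y Ey <-]]; have [p [z [cp Ez ->]]] := IH y Ey.
have N0 j : (0 : R) < (n j ^ m)%:R.
  by rewrite ltr0n expn_gt0; have := n2 j; lia.
have n0 j : (0 : R) < (n j)%:R by rewrite ltr0n; have := n2 j; lia.
have cE' (w : 'rV[R]_d) : sponge_map i (cmap n m p w) = cmap n m.+1 (pcomp n m (fun j => i j) p) w.
  apply/rowP => j; rewrite !mxE expnS /pcomp !natrD !natrM.
  by rewrite frac_comp ?lt0r_neq0.
exists (pcomp n m (fun j => i j) p), z; split=> //; split=> [j|w Ew].
  rewrite /pcomp expnS; have := ltn_ord (i j); have := proj1 cp j.
  move: (n j ^ m)%N (p j) => N q; nia.
rewrite -cE' {1}ED; exists i => //; exists (cmap n m p w) => //.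
exact: (proj2 cp).
Qed.

Lemma not_degenerated_neq n E : self_affine n E -> ~ degenerated E ->
  forall a (b : bool), exists2 x, E x & x 0 a != b%:R.
Proof.
move=> sa nd a b; apply: contrapT => h; apply: nd; exists a, b => x Ex; split.
  by move=> k; exact: (sa_unit sa).
by apply/eqP/negPn/negP => xa; apply: h; exists x.
Qed.

Lemma first_coords_prop (P : forall j, set 'rV[R]_j -> Prop) E :
  P d E -> (forall j : 'I_d, (1 <= j)%N -> P j (coord_proj j @` E)) ->
  forall a : 'I_d, P a.+1 (first_coords (ltn_ord a) @` E).
Proof.
move=> PE Pproj a; have := ltn_ord a; move: (ltn_ord a) => h.
rewrite leq_eqVlt => /predU1P[ad|ad].
  suff H j (hj : (j <= d)%N) : j = d -> P j (first_coords hj @` E) by exact: H.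
  move=> jd; case: _ / (esym jd) hj => hj.
  rewrite (_ : _ @` E = E) //; apply/seteqP; split=> [_ [x Ex <-]|x Ex].
    rewrite (_ : first_coords hj x = x) //; apply/rowP => k; rewrite mxE.
    by congr (x 0 _); exact: val_inj.
  exists x => //; apply/rowP => k; rewrite mxE.
  by congr (x 0 _); exact: val_inj.
have := Pproj (Ordinal ad) isT; rewrite /coord_proj /first_coords /=.
by rewrite (bool_irrelevance (ltnW (ltn_ord (Ordinal ad))) h).
Qed.

End Sponges.

Theorem corollary1p3 (R : realType) (d : nat) (hd : (2 <= d)%N)
    (E E' : set 'rV[R]_d)
    (hE : sierpinski_sponge E) (hE' : sierpinski_sponge E')
    (ndE : ~ degenerated E) (ndE' : ~ degenerated E')
    (hEE' : lipschitz_equivalent E E') :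
  ((has_trivial_point E /\
    (forall j : 'I_d, (1 <= j)%N -> has_trivial_point (coord_proj j @` E))) ->
   (has_trivial_point E' /\
    (forall j : 'I_d, (1 <= j)%N -> has_trivial_point (coord_proj j @` E'))))
  /\
  ((totally_disconnected E /\
    (forall j : 'I_d, (1 <= j)%N -> totally_disconnected (coord_proj j @` E))) ->
   (totally_disconnected E' /\
    (forall j : 'I_d, (1 <= j)%N -> totally_disconnected (coord_proj j @` E')))).
Proof.
have [n sa mono] := sponge_self_affine hE.
have [n' sa' mono'] := sponge_self_affine hE'.
have nd := not_degenerated_neq sa ndE; have nd' := not_degenerated_neq sa' ndE'.
have [f [c [fbij c0 fLip]]] := hEE'.
have [fE _ fsurj] := fbij.
pose K C := c * (d%:R * (C * (c * d.+1%:R))).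
have K0 C : 0 <= C -> 0 <= K C.
  by move=> C0; rewrite /K !mulr_ge0 // ltW.
split=> -[hT hTj].
- have hI (a : 'I_d) : island (first_coords (ltn_ord a) @` E).
    have saa := self_affine_first_coords sa (ltn_ord a).
    have nl := first_coords_mono mono (ltn_ord a) (l := ord_max) erefl.
    apply: (trivial_point_island saa nl); first exact: first_coords_neq.
    exact: (first_coords_prop (P := fun j X => has_trivial_point X)).
  have [C [y [C0 Ey uy]]] := islands_uniformly_trivial sa mono hI.
  have uy' := uniformly_trivial_bilipschitz fbij c0 fLip C0 Ey uy.
  have E'y' := fE _ Ey.
  split=> [|j j1].
    by exists (f y); exact: (uniformly_trivial_trivial_point (K0 _ C0)).
  (* Radius 1/2 keeps the widths of the part below 1, as [small_island] requires. *)
  have h4 : (0 : R) < 1 / 2 by [].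
  have [k hk] := uniformly_trivial_first_coords sa' mono' j (K0 _ C0) h4.
  have [p [x [cp E'x xE]]] := sa_cover sa' k E'y'.
  rewrite xE in uy'.
  have [e [G [e0 iG Gx hG]]] := hk _ _ cp E'x uy'.
  have saj := self_affine_first_coords sa' (ltnW (ltn_ord j)).
  (* Coordinates start at 0, so [j.-1] has the largest base among the first [j]. *)
  have jl : (j.-1 < j)%N by rewrite ltn_predL.
  have nl := first_coords_mono mono' (ltnW (ltn_ord j)) (l := Ordinal jl)
    (esym (prednK j1)).
  apply: (island_trivial_point saj nl).
  apply: (small_island saj nl (first_coords_neq _ nd') e0 iG); first by exists (first_coords (ltnW (ltn_ord j)) x).
  move=> u v i Gu Gv; have := closeD (close_sym (hG _ Gu)) (hG _ Gv).
  by move=> /(_ i) h; apply: lt_le_trans h _; lra.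
- have [C C0 hC] : exists2 C, 0 <= C & forall y, E y -> uniformly_trivial C E y.
    apply: (totally_disconnected_uniformly_trivial sa mono).
    exact: (first_coords_prop (P := fun j X => totally_disconnected X)).
  have uE' y' : E' y' -> uniformly_trivial (K C) E' y'.
    move=> /fsurj[y Ey <-].
    exact: (uniformly_trivial_bilipschitz fbij c0 fLip C0 Ey (hC y Ey)).
  split=> [y' E'y'|j j1 _ [x E'x <-]].
    by have [] := uniformly_trivial_trivial_point (K0 _ C0) E'y' (uE' _ E'y').
  suff [] : trivial_point (coord_proj j @` E') (coord_proj j x) by [].
  apply: detached_trivial_point => [|eta eta0]; first by exists x.
  have [k hk] := uniformly_trivial_first_coords sa' mono' j (K0 _ C0) eta0.
  (* Any cell of rank [k] will do: the copy of [x] in it is a point of [E'], hence uniformly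
     trivial. *)
  have [p [_ [cp _ _]]] := sa_cover sa' k E'x.
  exact: hk cp E'x (uE' _ (proj2 cp _ E'x)).
Qed.
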